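(* Let $2\le k\le n$ and let $\lambda=(\lambda_1,\dots,\lambda_n)\in\Gamma_k$ with $\lambda_2\ge\cdots\ge\lambda_n$. Let $\delta,\varepsilon\in(0,1)$, and suppose that $\lambda_1>0$, $\lambda_n<0$, $\lambda_1\ge\delta\lambda_2$ and $-\lambda_n\ge\varepsilon\lambda_1$. Then $$\sigma_m(\lambda|1)\ \ge\ c_0\,\sigma_m(\lambda)\qquad\text{for all } m=0,1,\dots,k-1,$$ where $c_0=\min\left\{\frac{\varepsilon^2\delta^2}{2(n-2)(n-1)},\ \frac{\varepsilon^2\delta}{4(n-1)}\right\}$. Moreover, for every integer $l$ with $0\le l<k$, $$\frac{\partial}{\partial\lambda_1}\left[\frac{\sigma_k(\lambda)}{\sigma_l(\lambda)}\right]\ \ge\ c_1\sum_{i=1}^n\frac{\partial}{\partial\lambda_i}\left[\frac{\sigma_k(\lambda)}{\sigma_l(\lambda)}\right],$$ where $c_1=\frac{n}{k}\,\frac{k-l}{n-l}\,\frac{c_0^2}{n-k+1}$.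
   Context: For $\lambda\in\mathbb{R}^n$, $\sigma_j(\lambda)=\sum_{1\le i_1<\cdots<i_j\le n}\lambda_{i_1}\cdots\lambda_{i_j}$ and $\sigma_0=1$. $\sigma_m(\lambda|i)$ denotes $\sigma_m(\lambda)$ with $\lambda_i$ set equal to $0$. $\Gamma_k=\{\lambda\in\mathbb{R}^n:\sigma_i(\lambda)>0 \text{ for all } 1\le i\le k\}$. (The hypotheses $\lambda\in\Gamma_k$, $k\ge2$, $\lambda_n<0$ force $n\ge3$, so $c_0$ is well defined.) *)

(* Defs.v *)
From HB Require Import structures.
From mathcomp Require Import all_boot all_order all_algebra.
From mathcomp Require Import all_classical all_reals all_analysis.
Import Order.TTheory GRing.Theory Num.Theory.
Import numFieldNormedType.Exports.

Set Implicit Arguments.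
Unset Strict Implicit.
Unset Printing Implicit Defensive.

Local Open Scope ring_scope.

(* The strictly increasing index tuples i_1 < ... < i_j are encoded as the
   j-element subsets of 'I_n. *)
Definition sigma (R : realType) (n j : nat) (lam : 'rV[R]_n) : R :=
  \sum_(A : {set 'I_n} | #|A| == j) \prod_(i in A) lam ord0 i.

Lemma sigma0 (R : realType) (n : nat) (lam : 'rV[R]_n) : sigma 0 lam = 1.
Proof.
rewrite /sigma (big_pred1 (finset.set0 : {set 'I_n})) ?big_set0// => A.
by rewrite cards_eq0.
Qed.

(* sigma_m(lambda | i) *)
Definition sigma_del (R : realType) (n m : nat) (lam : 'rV[R]_n) (i : 'I_n)
    : R :=
  sigma m (\row_j (if j == i then 0 else lam ord0 j)).

Definition Gamma (R : realType) (n k : nat) (lam : 'rV[R]_n) : Prop :=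
  forall i : nat, (1 <= i <= k)%N -> 0 < sigma i lam.

(* Derivative along the i-th vector of the canonical basis. *)
Definition partial (R : realType) (n : nat) (i : 'I_n) (f : 'rV[R]_n -> R)
    (lam : 'rV[R]_n) : R :=
  'D_(delta_mx ord0 i) f lam.

Definition sigma_quot (R : realType) (n k l : nat) (lam : 'rV[R]_n) : R :=
  sigma k lam / sigma l lam.

Definition c0 (R : realType) (n : nat) (delta eps : R) : R :=
  Num.min
    (eps ^+ 2 * delta ^+ 2 / (2 * (n%:R - 2) * (n%:R - 1)))
    (eps ^+ 2 * delta / (4 * (n%:R - 1))).

Definition c1 (R : realType) (n k l : nat) (delta eps : R) : R :=
  n%:R / k%:R * ((k%:R - l%:R) / (n%:R - l%:R)) *
  (c0 n delta eps ^+ 2 / (n%:R - k%:R + 1)).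

(* Main.v *)
Require Import Defs.
From HB Require Import structures.
From mathcomp Require Import all_boot all_order all_algebra.
From mathcomp Require Import all_classical all_reals all_analysis.
From mathcomp Require Import ring lra zify.
Import Order.TTheory GRing.Theory Num.Theory.
Import numFieldNormedType.Exports.
Local Open Scope ring_scope.

(** Write [e_j(A)] for the elementary symmetric functions of the entries
    indexed by a set [A], and [B] for the full index set with [1] removed.

    Two facts about the cones carry everything.  Deleting any entry maps
    [Gamma_(k+1)] into [Gamma_k] ([cone_del]), and inside the cones the
    sharp Newton inequalities hold ([newton]), hence their telescoped form
    comparing [e_(k+1) e_l] with [e_k e_(l+1)] ([newton_maclaurin]).
    Deletion and Newton are proved together by induction on the number of
    entries, which keeps the argument inside the cones and avoids
    real-rooted polynomials:
    Newton for [A] follows from Newton for [A] minus a positive entry by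
    completing a square, and the deletion of a positive entry follows by
    first deleting a nonpositive one (always harmless) and applying Newton
    to what is left once both are gone; if all other entries are positive,
    there is nothing to prove.

    First inequality.  By Euler-type identities,
      [(m+2) e_(m+2)(B) = e_1(B) e_(m+1)(B) - sum_(a in B) x_a^2 e_m(B \ a)],
    where the sum is at least [x_n^2 e_m(B)] because [x_n <= 0].  Since
    [e_(m+2)(B) > - x_1 e_(m+1)(B)], this bounds [e_m(B)] by a multiple of
    [e_(m+1)(B)] ([esp_del_lower]).  As [x_n^2 >= eps^2 x_1^2] and
    [e_1(B) <= (n-2) x_1 / delta], it gives
      [eps^2 delta x_1 e_m(B) <= 2 (n-1) e_(m+1)(B)],
    so that [e_(m+1)(B)] is comparable to [sigma_(m+1)], which is
    [x_1 e_m(B) + e_(m+1)(B)] ([sigma_del_ge]).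

    Second inequality.  Each [sigma_j] is affine in [x_1] with slope
    [sigma_(j-1)(.|1)].  Hence the numerator of the derivative of
    [sigma_k / sigma_l] is [e_(k-1)(B) e_l(B) - e_k(B) e_(l-1)(B)], and
    Newton-Maclaurin bounds it below by [n (k-l) / (k (n-l))] times
    [e_(k-1)(B) e_l(B)] ([sigma_quot_numerator_ge]); the first inequality
    turns this product into [c0^2 sigma_(k-1) sigma_l].  The sum of all
    partial derivatives is at most [(n-k+1) sigma_(k-1) / sigma_l]
    ([sum_dsigmaS]), and the quotient of the two bounds is [c1]. *)

Set Implicit Arguments.
Unset Strict Implicit.

(** * Elementary symmetric functions of a subfamily *)

Section SymmetricFunctions.
Context (R : realFieldType) (I : finType) (x : I -> R).
Implicit Types (A : {set I}) (i : I) (j k : nat).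

(** Keeping the family [x] fixed and letting the index set vary turns the
    deletion of an entry into [A :\ i], and the coefficients of this product
    obey the deletion recursion with no sum over subsets. *)
Definition genpoly A : {poly R} := \prod_(i in A) (1 + x i *: 'X).

Definition esp A j : R := (genpoly A)`_j.

Definition cone A k := forall j, (j <= k)%N -> 0 < esp A j.

Lemma genpolyD1 A i : i \in A ->
  genpoly A = (1 + x i *: 'X) * genpoly (A :\ i).
Proof. by move=> iA; rewrite /genpoly (big_setD1 i). Qed.

Lemma esp0 A : esp A 0 = 1.
Proof.
rewrite /esp -horner_coef0 /genpoly horner_prod big1// => i _.
by rewrite !hornerE.
Qed.

Lemma espS A i j : i \in A ->
  esp A j.+1 = esp (A :\ i) j.+1 + x i * esp (A :\ i) j.
Proof.
move=> /genpolyD1 /(congr1 (fun p : {poly R} => p`_j.+1)).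
by rewrite mulrDl mul1r coefD -scalerAl coefZ coefXM.
Qed.

Lemma esp_gt_card A j : (#|A| < j)%N -> esp A j = 0.
Proof.
have [m] := ubnP #|A|; elim: m A j => // m IHm A [//|j] Am Aj.
have [->|[i iA]] := set_0Vmem A.
  by rewrite /esp /genpoly big_set0 coef1.
have cA := cardsD1 i A; rewrite iA /= in cA.
by rewrite (espS j iA) !IHm ?mulr0 ?addr0//; lia.
Qed.

Lemma esp_pos A j : (forall i, i \in A -> 0 < x i) -> (j <= #|A|)%N ->
  0 < esp A j.
Proof.
have [m] := ubnP #|A|; elim: m A j => // m IHm A [|j] Am xA Aj.
  by rewrite esp0.
have [A0|[i iA]] := set_0Vmem A; first by rewrite A0 cards0 in Aj.
have cA := cardsD1 i A; rewrite iA /= in cA.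
have xB a : a \in A :\ i -> 0 < x a by rewrite in_setD1 => /andP[_ /xA].
have p : 0 < x i * esp (A :\ i) j.
  by rewrite mulr_gt0 ?xA// IHm//; lia.
rewrite (espS j iA).
have [jA|jA] := leqP j.+1 #|A :\ i|.
  by rewrite addr_gt0// IHm//; lia.
by rewrite esp_gt_card// add0r.
Qed.

Lemma cone_card A k : cone A k -> (k <= #|A|)%N.
Proof.
move=> cA; rewrite leqNgt; apply/negP => /esp_gt_card Ak.
by have := cA k (leqnn k); rewrite Ak ltxx.
Qed.

Lemma cone_le A j k : (j <= k)%N -> cone A k -> cone A j.
Proof. by move=> jk cA a aj; apply: cA; apply: leq_trans jk. Qed.

Lemma deriv_genpoly A :
  (genpoly A)^`() = \sum_(i in A) x i *: genpoly (A :\ i).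
Proof.
have [m] := ubnP #|A|; elim: m A => // m IHm A Am.
have [->|[i iA]] := set_0Vmem A.
  by rewrite /genpoly !big_set0 derivC.
have cA := cardsD1 i A; rewrite iA /= in cA.
rewrite (genpolyD1 iA) derivM IHm; last by lia.
rewrite derivD derivC add0r derivZ derivX -[_ *: 1 * _]scalerAl mul1r.
rewrite (big_setD1 i iA) /=; congr (_ + _); rewrite big_distrr /=.
apply: eq_bigr => a; rewrite in_setD1 => /andP[ai aA].
have iAa : i \in A :\ a by rewrite in_setD1 eq_sym ai.
rewrite (genpolyD1 iAa) -scalerAr; congr (_ *: (_ * genpoly _)).
by rewrite !finset.setDDl finset.setUC.
Qed.

(** Coefficients of the logarithmic derivative identity [deriv_genpoly]:
    Euler's relation for the homogeneous function [esp A j.+1]. *)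
Lemma sum_x_esp A j :
  \sum_(i in A) x i * esp (A :\ i) j = j.+1%:R * esp A j.+1.
Proof.
have := congr1 (fun p : {poly R} => p`_j) (deriv_genpoly A).
rewrite mulr_natl coef_deriv coef_sum => ->.
by apply: eq_bigr => i _; rewrite coefZ.
Qed.

Lemma esp1 A : esp A 1 = \sum_(i in A) x i.
Proof.
rewrite -[esp A 1]mul1r -(sum_x_esp A 0).
by apply: eq_bigr => i _; rewrite esp0 mulr1.
Qed.

(** Replace [x i * esp (A :\ i) j] by [esp A j.+1 - esp (A :\ i) j.+1]
    and apply Euler's relation twice. *)
Lemma sum_sqr_esp A j :
  \sum_(i in A) x i ^+ 2 * esp (A :\ i) j
    = esp A 1 * esp A j.+1 - j.+2%:R * esp A j.+2.
Proof.
rewrite -sum_x_esp esp1 mulr_suml -sumrB; apply: eq_bigr => i iA.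
by rewrite (espS j iA); ring.
Qed.

Lemma sum_esp_del A j :
  \sum_(i in A) esp (A :\ i) j = (#|A|%:R - j%:R) * esp A j.
Proof.
case: j => [|j].
  rewrite (eq_bigr (fun=> 1)); last by move=> i _; rewrite esp0.
  by rewrite sumr_const esp0 subr0 mulr1.
rewrite mulrBl -sum_x_esp mulr_natl -sumr_const -sumrB.
by apply: eq_bigr => i iA; rewrite (espS j iA) addrK.
Qed.

(** * Deletion and Newton inequalities in the cones *)

(** A nonpositive entry can be deleted without losing a degree: passing from
    [A] to [A :\ i] subtracts [x i * esp (A :\ i) j], which is nonpositive
    once degree [j] is known to be positive. *)
Lemma cone_del_le0 A i k : i \in A -> x i <= 0 -> cone A k ->
  cone (A :\ i) k.
Proof.
move=> iA xi cA; elim=> [|j IHj] jk; first by rewrite esp0.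
have := cA _ jk; have := IHj (ltnW jk); rewrite (espS j iA); nra.
Qed.

Lemma cone_pos_entry A k : cone A k.+1 -> exists2 i, i \in A & 0 < x i.
Proof.
move=> /(_ 1%N isT); rewrite esp1 => s0; apply/exists_inP.
apply: contraLR s0; rewrite negb_exists_in => /forall_inP xA.
by rewrite -leNgt; apply: sumr_le0 => i /xA; rewrite -leNgt.
Qed.

Definition cone_deletes A :=
  forall i k, i \in A -> cone A k.+1 -> cone (A :\ i) k.

(** Newton's inequality in sharp form: with [N = #|A|] and
    [p_j = esp A j / 'C(N, j)] it reads [p_j p_(j+2) <= p_(j+1)^2]. *)
Definition newton_on A := forall j, cone A j.+1 ->
  (j.+2 * (#|A| - j))%:R * (esp A j * esp A j.+2)
    <= (j.+1 * (#|A| - j.+1))%:R * esp A j.+1 ^+ 2.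

Lemma newton_weak A j : newton_on A -> cone A j.+1 ->
  esp A j * esp A j.+2 <= esp A j.+1 ^+ 2.
Proof.
move=> nA cA; have [z0|z0] := leP (esp A j.+2) 0.
  apply: le_trans (sqr_ge0 _); rewrite mulr_ge0_le0//.
  by apply/ltW/cA.
have jA : (j.+2 <= #|A|)%N.
  by rewrite leqNgt; apply/negP => /esp_gt_card z; rewrite z ltxx in z0.
have c0 : 0 < (j.+2 * (#|A| - j))%:R :> R by rewrite ltr0n; nia.
rewrite -(ler_pM2l c0); apply: le_trans (nA _ cA) _.
by rewrite ler_wpM2r ?sqr_ge0// ler_nat; nia.
Qed.

(** Let [x i > 0].  If the other entries are all positive, so are their
    symmetric functions.  If some other entry [x y] is nonpositive, let [p],
    [q], [r] be the functions of degrees [j], [j+1], [j+2] of the entries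
    other than [x i] and [x y].  If deleting [i] failed, [q + x_y p <= 0],
    then the positivity of [r + (x_i + x_y) q + x_i x_y p] would force
    [r > - x_y q >= q^2 / p], against Newton's inequality [p r <= q^2]. *)
Lemma cone_deletes_step A :
  (forall i, i \in A -> cone_deletes (A :\ i)) ->
  (forall i a, i \in A -> a \in A :\ i -> newton_on (A :\ i :\ a)) ->
  cone_deletes A.
Proof.
move=> IHd IHn i k iA cA.
have [xi|xi] := leP (x i) 0.
  by apply: cone_del_le0 => //; apply: cone_le cA.
have cA' := cone_card cA.
have cAi := cardsD1 i A; rewrite iA /= in cAi.
have [/forall_inP pos|] := boolP [forall a in A :\ i, 0 < x a].
  by move=> j jk; apply: esp_pos => //; lia.
rewrite negb_forall_in => /exists_inP[y yAi]; rewrite -leNgt => y0.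
have [yi yA] := setD1P yAi.
have iAy : i \in A :\ y by rewrite in_setD1 eq_sym yi.
have cAy : cone (A :\ y) k.+1 by apply: cone_del_le0.
have cAyi := IHd y yA i k iAy cAy.
have E : A :\ i :\ y = A :\ y :\ i by rewrite !finset.setDDl finset.setUC.
case=> [|j] jk; first by rewrite esp0.
rewrite (espS j yAi) E ltNge; apply/negP => h.
have p0 := cAyi j (ltnW jk); have p1 := cAyi j.+1 jk.
have nw := newton_weak (IHn y i yA iAy) (cone_le jk cAyi).
have := cA j.+2 jk; rewrite (espS _ iA) !(espS _ yAi) E.
set p := esp _ j in p0 p1 nw h *; set q := esp _ j.+1 in p0 p1 nw h *.
set r := esp _ j.+2 in nw *.
move=> H.
(* [H] expands to [(r + x y * q) + x i * (q + x y * p)]. *)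
have H1 : 0 < r + x y * q by nra.
have H2 : 0 < p * r + x y * p * q by nra.
nra.
Qed.

(** Here [u], [v], [w], [z] are consecutive symmetric functions of degrees
    [J-2] to [J+1] of [J + m - 1] entries, and [t] is an additional entry.
    The two Newton inequalities, with nonnegative defects [A] and [B],
    multiply to a third one with defect [C], and [J m] times the new defect
    is [(J w - m t v)^2] plus a nonnegative combination of [A], [B], [C]. *)
Lemma newton_add_entry (J m u v w z t : R) : 1 <= J -> 1 <= m ->
  0 <= u -> 0 < v -> 0 < w -> 0 <= t ->
  (J + 1) * m * (v * z) <= J * (m - 1) * w ^+ 2 ->
  J * (m + 1) * (u * w) <= (J - 1) * m * v ^+ 2 ->
  (J + 1) * (m + 1) * ((v + t * u) * (z + t * w))
    <= J * m * (w + t * v) ^+ 2.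
Proof.
move=> J1 m1 u0 v0 w0 t0 Ha Hb.
have J0 : 0 < J by lra.
have m0 : 0 < m by lra.
have Jm0 : 0 < J * m by apply: mulr_gt0.
have Hc : (J + 1) * (m + 1) * (u * z) <= (J - 1) * (m - 1) * (v * w).
  have [z0|z0] := leP z 0.
    apply: (@le_trans _ _ 0); last by rewrite !mulr_ge0//; lra.
    by rewrite mulr_ge0_le0//; [nra|rewrite mulr_ge0_le0].
  have P0 : 0 < J * m * (v * w) by rewrite !mulr_gt0.
  rewrite -(ler_pM2l P0).
  have H := ler_pM _ _ Ha Hb; rewrite -subr_ge0.
  have : 0 <= J * (m - 1) * w ^+ 2 * ((J - 1) * m * v ^+ 2)
    - (J + 1) * m * (v * z) * (J * (m + 1) * (u * w)).
    rewrite subr_ge0; apply: H; rewrite !mulr_ge0//; lra.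
  by congr (_ <= _); ring.
rewrite -subr_ge0 -(pmulr_rge0 _ Jm0).
set A := J * (m - 1) * w ^+ 2 - (J + 1) * m * (v * z).
set B := (J - 1) * m * v ^+ 2 - J * (m + 1) * (u * w).
set C := (J - 1) * (m - 1) * (v * w) - (J + 1) * (m + 1) * (u * z).
suff -> : J * m * (J * m * (w + t * v) ^+ 2 -
    (J + 1) * (m + 1) * ((v + t * u) * (z + t * w)))
  = (J * w - t * (m * v)) ^+ 2 + J * (m + 1) * A
    + t ^+ 2 * (m * (J + 1) * B) + J * m * (t * C).
  have A0 : 0 <= A by rewrite subr_ge0.
  have B0 : 0 <= B by rewrite subr_ge0.
  have C0 : 0 <= C by rewrite subr_ge0.
  by rewrite !addr_ge0 ?sqr_ge0// !mulr_ge0 ?sqr_ge0//; lra.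
by rewrite /A /B /C; ring.
Qed.

(** If [esp A j.+2 <= 0] there is nothing to prove; otherwise [A] lies in the
    next cone, so that removing a positive entry leaves [esp] positive up to
    degree [j.+1], as [newton_add_entry] requires. *)
Lemma newton_step A : cone_deletes A ->
  (forall i, i \in A -> newton_on (A :\ i)) -> newton_on A.
Proof.
move=> dA IHn j cA.
have [z0|z0] := leP (esp A j.+2) 0.
  apply: (@le_trans _ _ 0); last by rewrite mulr_ge0 ?sqr_ge0// ler0n.
  rewrite mulr_ge0_le0 ?ler0n// mulr_ge0_le0//.
  by apply/ltW/cA.
have cA2 : cone A j.+2.
  by move=> a; rewrite leq_eqVlt => /orP[/eqP->//|]; apply: cA.
have [i iA xi] := cone_pos_entry cA.
have cB := dA i _ iA cA2.
have jA := cone_card cA2.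
have cAi := cardsD1 i A; rewrite iA /= in cAi.
have Ha := IHn i iA j cB.
have [m Em] : exists m, #|A| = (m.+1 + j.+1)%N.
  by exists (#|A| - j.+2)%N; lia.
have -> : (j.+2 * (#|A| - j))%:R = (j.+1%:R + 1) * (m.+1%:R + 1) :> R.
  by rewrite !natr1 -natrM; congr (_%:R); rewrite Em; nia.
have -> : (j.+1 * (#|A| - j.+1))%:R = j.+1%:R * m.+1%:R :> R.
  by rewrite -natrM; congr (_%:R); rewrite Em; nia.
have EB : #|A :\ i| = (m + j.+1)%N by lia.
have Ha' : (j.+1%:R + 1) * m.+1%:R * (esp (A :\ i) j * esp (A :\ i) j.+2)
    <= j.+1%:R * (m.+1%:R - 1) * esp (A :\ i) j.+1 ^+ 2 :> R.
  move: Ha; rewrite EB.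
  have -> : (j.+2 * (m + j.+1 - j))%N = ((j.+1 + 1) * m.+1)%N by nia.
  have -> : (m + j.+1 - j.+1)%N = m by lia.
  by rewrite !natrM natrD -[m.+1%:R]natr1 addrK.
have [b0 b1] : 0 < esp (A :\ i) j /\ 0 < esp (A :\ i) j.+1.
  by split; apply: cB.
have J1 : 1 <= j.+1%:R :> R by rewrite ler1n.
have m1 : 1 <= m.+1%:R :> R by rewrite ler1n.
rewrite (espS j.+1 iA) (espS j iA).
case: j => [|j] in cA z0 cA2 cB jA Ha Em EB Ha' b0 b1 J1 *.
  (* The function of degree -1 is read as 0. *)
  have := @newton_add_entry 1 m.+1%:R 0 1
    (esp (A :\ i) 1) (esp (A :\ i) 2) (x i).
  rewrite !esp0 mulr0 addr0 in Ha' *; apply => //; first exact: ltW.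
  by rewrite !mul0r mulr0 subrr !mul0r.
rewrite (espS j iA).
apply: newton_add_entry => //; [|exact: ltW|].
  exact/ltW/cB/ltnW.
have := IHn i iA j (cone_le (leqnSn _) cB); rewrite EB.
have -> : (m + j.+2 - j)%N = (m.+1 + 1)%N by clear; lia.
have -> : (m + j.+2 - j.+1)%N = m.+1 by clear; lia.
by rewrite !natrM natrD -[j.+2%:R]natr1 addrK.
Qed.

Lemma cone_deletes_and_newton A : cone_deletes A /\ newton_on A.
Proof.
have [m] := ubnP #|A|; elim: m A => // m IHm A Am.
have IH i : i \in A -> cone_deletes (A :\ i) /\ newton_on (A :\ i).
  by move=> iA; apply: IHm; have := cardsD1 i A; rewrite iA /=; lia.
have dA : cone_deletes A.
  apply: cone_deletes_step => [i /IH[]//|i a iA aA].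
  have [|//] := IHm (A :\ i :\ a).
  have := cardsD1 i A; have := cardsD1 a (A :\ i).
  by rewrite iA aA /=; lia.
by split=> //; apply: newton_step => // i /IH[].
Qed.

Lemma cone_del A i k : i \in A -> cone A k.+1 -> cone (A :\ i) k.
Proof. by have [+ _] := cone_deletes_and_newton A; apply. Qed.

Lemma newton A : newton_on A.
Proof. by case: (cone_deletes_and_newton A). Qed.

(** Newton's inequalities say that [p_(j+1) / p_j] is nonincreasing in [j] for
    the normalized functions; this compares the ratios at [k] and [l].  Only
    [esp A k.+1] may fail to be positive. *)
Lemma newton_maclaurin A k l : (l <= k)%N -> cone A k ->
  (k.+1 * (#|A| - l))%:R * (esp A k.+1 * esp A l)
    <= (l.+1 * (#|A| - k))%:R * (esp A k * esp A l.+1).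
Proof.
move=> lk; have [d ->] : exists d, k = (d + l)%N by exists (k - l)%N; lia.
elim: d {k lk} => [|d IHd] cA; first by rewrite add0n [esp A _.+1 * _]mulrC.
rewrite addSn in cA *; set k := (d + l)%N in IHd cA *.
have [z0|z0] := leP (esp A k.+2) 0.
  apply: (@le_trans _ _ 0).
    rewrite mulr_ge0_le0 ?ler0n// mulr_le0_ge0//.
    by apply/ltW/cA; rewrite /k; lia.
  by rewrite !mulr_ge0 ?ler0n//; apply/ltW/cA; rewrite /k; lia.
have {}IHd := IHd (cone_le (leqnSn _) cA).
have nA := newton cA.
have kA := cone_card cA.
have p0 : 0 < esp A k by apply: cA.
have p1 : 0 < esp A k.+1 by apply: cA.
have l0 : 0 < esp A l by apply: cA; rewrite /k; lia.
have P0 : 0 < (k.+1 * (#|A| - k))%:R * (esp A k * esp A k.+1).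
  by rewrite !mulr_gt0// ltr0n; nia.
rewrite -(ler_pM2l P0).
have H := ler_pM _ _ nA IHd; rewrite -subr_ge0.
have {H} : 0 <= (k.+1 * (#|A| - k.+1))%:R * esp A k.+1 ^+ 2 *
     ((l.+1 * (#|A| - k))%:R * (esp A k * esp A l.+1)) -
   (k.+2 * (#|A| - k))%:R * (esp A k * esp A k.+2) *
     ((k.+1 * (#|A| - l))%:R * (esp A k.+1 * esp A l)).
  by rewrite subr_ge0; apply: H; rewrite !mulr_ge0 ?ler0n// ltW.
by congr (_ <= _); rewrite !natrM; ring.
Qed.

(** The entry [x y <= 0] makes [esp (A :\ i) m] small compared with
    [esp (A :\ i) m.+1]: in [sum_sqr_esp] for [A :\ i] the term of index [y]
    alone contributes [x y ^+ 2 * esp (A :\ i) m], while positivity of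
    [esp A m.+2] bounds the total from above.  The factor [#|A| - 2] arises
    since [x y] can be dropped from [esp (A :\ i) 1]. *)
Lemma esp_del_lower A i y M m : i \in A -> y \in A :\ i ->
  x y <= 0 -> (forall a, a \in A :\ i -> x a <= M) -> cone A m.+2 ->
  x y ^+ 2 * esp (A :\ i) m
    <= (m.+2%:R * x i + (#|A| - 2)%:R * M) * esp (A :\ i) m.+1.
Proof.
move=> iA yB y0 xM cA; set B := A :\ i in yB xM *.
have cB : cone B m.+1 by apply: cone_del.
have b1 : 0 < esp B m.+1 by apply: cB.
have e1 : esp B 1 <= (#|A| - 2)%:R * M.
  rewrite esp1 (big_setD1 y yB) /=.
  have -> : (#|A| - 2)%N = #|B :\ y|.
    by have := cardsD1 i A; have := cardsD1 y B; rewrite iA yB -/B /=; lia.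
  rewrite mulr_natl -sumr_const -[leRHS]add0r lerD// ler_sum// => a.
  by rewrite in_setD1 => /andP[_ /xM].
have s : x y ^+ 2 * esp B m
    <= \sum_(a in B) x a ^+ 2 * esp (B :\ a) m.
  rewrite (big_setD1 y yB) /= -[leLHS]addr0 lerD//.
    rewrite ler_wpM2l ?sqr_ge0//; case: m cA cB b1 => [|m] cA cB b1.
      by rewrite !esp0.
    have := cone_del yB cB (leqnSn m).
    by rewrite (espS m yB); nra.
  rewrite sumr_ge0// => a; rewrite in_setD1 => /andP[_ aB].
  by rewrite mulr_ge0 ?sqr_ge0// ltW//; apply: cone_del aB cB _ _.
apply: le_trans s _; rewrite sum_sqr_esp.
have := cA m.+2 (leqnn _); rewrite (espS _ iA) -/B => h.
have : m.+2%:R * 0 <= m.+2%:R * (esp B m.+2 + x i * esp B m.+1).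
  by rewrite ler_pM2l ?ltr0n// ltW.
have : esp B 1 * esp B m.+1 <= (#|A| - 2)%:R * M * esp B m.+1.
  by rewrite ler_pM2r.
lra.
Qed.

End SymmetricFunctions.

(** * The functions sigma, their derivatives and the constants *)

Section Sigma.
Context (R : realType) (n : nat).
Implicit Types (lam : 'rV[R]_n) (i : 'I_n) (j k l m : nat).

Lemma in_setT_ord i : i \in [set: 'I_n].
Proof. by rewrite finset.in_setT. Qed.

Lemma sigmaE j lam : sigma j lam = esp (fun i => lam ord0 i) [set: 'I_n] j.
Proof.
rewrite /esp /genpoly (eq_bigl xpredT); last by move=> i; apply: in_setT_ord.
under eq_bigr do rewrite addrC.
rewrite bigA_distr coef_sum /sigma big_mkcond /=.
apply: eq_bigr => A _.
rewrite -big_mkcond scaler_prod prodr_const coefZ coefXn eq_sym.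
by case: eqP => _; rewrite ?mulr1 ?mulr0.
Qed.

Lemma eq_esp (x y : 'I_n -> R) (A : {set 'I_n}) :
  (forall i, i \in A -> x i = y i) -> esp x A =1 esp y A.
Proof.
move=> xy j; rewrite /esp /genpoly.
by under eq_bigr => i iA do rewrite (xy i iA).
Qed.

(** An entry equal to zero contributes the factor [1] to the generating
    polynomial, so setting it to zero amounts to removing its index. *)
Lemma sigma_delE m lam i :
  sigma_del m lam i = esp (fun a => lam ord0 a) ([set: 'I_n] :\ i) m.
Proof.
rewrite /sigma_del sigmaE.
case: m => [|m]; first by rewrite !esp0.
rewrite (espS _ _ (in_setT_ord i)) mxE eqxx mul0r addr0.
by apply: eq_esp => a; rewrite in_setD1 mxE => /andP[/negPf -> _].
Qed.

Lemma cone_Gamma k lam : Gamma k lam ->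
  cone (fun i => lam ord0 i) [set: 'I_n] k.
Proof.
by move=> G [|j] jk; [rewrite esp0 | rewrite -sigmaE; apply: G].
Qed.

(** The partial derivative of [sigma j] in the direction [i]; for [j = 0] it
    vanishes, which is the convention [sigma_(-1) = 0]. *)
Definition dsigma j lam i : R := if j is j'.+1 then sigma_del j' lam i else 0.

Lemma sigma_line j lam i (h : R) :
  sigma j (h *: delta_mx ord0 i + lam) = sigma j lam + h * dsigma j lam i.
Proof.
case: j => [|j] /=; first by rewrite !sigma0 mulr0 addr0.
rewrite !sigmaE !(espS _ _ (in_setT_ord i)) sigma_delE.
set y := fun a => (h *: delta_mx ord0 i + lam) ord0 a.
have E : esp y ([set: 'I_n] :\ i)
    =1 esp (fun a => lam ord0 a) ([set: 'I_n] :\ i).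
  apply: eq_esp => a; rewrite in_setD1 /y !mxE => /andP[/negPf -> _].
  by rewrite andbF mulr0 add0r.
by rewrite !E /y !mxE !eqxx mulr1; ring.
Qed.

Lemma derive_affine_quot (s t a b : R) : t != 0 ->
  'D_1 (fun h : R => (s + h * a) / (t + h * b)) (0 : R)
    = (a * t - s * b) / t ^+ 2.
Proof.
move=> t0; pose N : R -> R := cst s + id * cst a.
pose D : R -> R := cst t + id * cst b.
rewrite -[X in derive X _ _]/(N * (fun h => (D h)^-1)).
have dA (p q : R) : is_derive (0 : R) (1 : R) (cst p + id * cst q : R -> R) q.
  have dM := @is_deriveM _ _ id (cst q) 0 1 _ _
    (@is_derive_id R R^o 0 1) (@is_derive_cst R R^o R^o q 0 1).
  have := is_deriveD (@is_derive_cst R R^o R^o p 0 1) dM.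
  by rewrite scaler0 !add0r [_ *: _]mulr1.
have dN : is_derive (0 : R) (1 : R) N a := dA s a.
have dD : is_derive (0 : R) (1 : R) D b := dA t b.
have D0 : D 0 = t by rewrite /D /= !fctE mul0r addr0.
have N0 : N 0 = s by rewrite /N /= !fctE mul0r addr0.
have derN : derivable N 0 1 := @ex_derive _ _ _ _ _ _ _ dN.
have derD : derivable D 0 1 := @ex_derive _ _ _ _ _ _ _ dD.
have eN : 'D_1 N 0 = a := @derive_val _ _ _ _ _ _ _ dN.
have eD : 'D_1 D 0 = b := @derive_val _ _ _ _ _ _ _ dD.
clearbody N D; clear dA dN dD.
have derV : derivable (fun h => (D h)^-1) 0 1.
  by apply: derivableV; rewrite ?D0.
rewrite (deriveM derN derV) deriveV ?D0// eN eD N0 /GRing.scale /=.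
by field.
Qed.

(** Along a coordinate direction numerator and denominator are affine, so
    the directional derivative is that of a quotient of affine functions. *)
Lemma partial_sigma_quot k l lam i : sigma l lam != 0 ->
  partial i (sigma_quot k l) lam =
  (dsigma k lam i * sigma l lam - sigma k lam * dsigma l lam i)
    / sigma l lam ^+ 2.
Proof.
move=> sl0; rewrite -(derive_affine_quot _ _ _ sl0).
have line h : sigma_quot k l (h *: delta_mx ord0 i + lam)
    = (sigma k lam + h * dsigma k lam i) / (sigma l lam + h * dsigma l lam i).
  by rewrite /sigma_quot !sigma_line.
rewrite /partial /derive; set f := (X in fmap X _).
set g := (X in _ = lim (fmap X _)).
suff -> : f = g by [].
rewrite /f /g; apply/funext => h /=; rewrite line !addr0 [h *: 1]mulr1.
by rewrite /sigma_quot !mul0r !addr0.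
Qed.

Lemma sum_dsigmaS j lam :
  \sum_i dsigma j.+1 lam i = (n%:R - j%:R) * sigma j lam.
Proof.
rewrite sigmaE -[n in n%:R]card_ord -cardsT -sum_esp_del.
by apply: eq_big => [i|i _]; rewrite ?finset.in_setT//= sigma_delE.
Qed.

Lemma sum_dsigma_ge0 j lam : (forall m, (m < j)%N -> 0 <= sigma m lam) ->
  (j <= n)%N -> 0 <= \sum_i dsigma j lam i.
Proof.
case: j => [|j] sj jn; first by rewrite /= big1.
by rewrite sum_dsigmaS mulr_ge0 ?sj// subr_ge0 ler_nat ltnW.
Qed.

(** In the numerator the terms containing [lam ord0 i] cancel, leaving
    [sigma_k(.|i) sigma_l(.|i) - sigma_(k+1)(.|i) sigma_(l-1)(.|i)]; by
    [newton_maclaurin] for the [n - 1] other entries the second product is at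
    most [l (n-k-1) / ((k+1) (n-l))] times the first. *)
Lemma sigma_quot_numerator_ge k l lam i :
  cone (fun a => lam ord0 a) [set: 'I_n] k.+1 ->
  (l <= k)%N ->
  n%:R / k.+1%:R * ((k.+1%:R - l%:R) / (n%:R - l%:R)) *
    (sigma_del k lam i * sigma_del l lam i)
  <= dsigma k.+1 lam i * sigma l lam - sigma k.+1 lam * dsigma l lam i.
Proof.
move=> cT lk; have kn := cone_card cT; rewrite cardsT card_ord in kn.
have cB := cone_del (in_setT_ord i) cT.
have k0 : 0 < k.+1%:R :> R by rewrite ltr0n.
have nl0 : 0 < n%:R - l%:R :> R by rewrite subr_gt0 ltr_nat; lia.
case: l => [|l] in lk nl0 *.
  (* Both sides equal [sigma_del k lam i]. *)
  rewrite /= sigma0 mulr0 !subr0 /sigma_del sigma0 -/(sigma_del k lam i).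
  rewrite subr0 in nl0.
  by rewrite le_eqVlt; apply/orP; left; apply/eqP; field; rewrite !gt_eqF.
have cardB : #|[set: 'I_n] :\ i| = n.-1.
  have := cardsD1 i [set: 'I_n]; rewrite finset.in_setT cardsT card_ord add1n.
  by move=> /(congr1 predn).
have := newton_maclaurin (ltnW lk) cB; rewrite cardB -!sigma_delE.
have -> : (n.-1 - l)%N = (n - l.+1)%N by lia.
have -> : (n.-1 - k)%N = (n - k.+1)%N by lia.
rewrite !natrM !natrB; [|lia|lia] => H.
rewrite /= !sigmaE !(espS _ _ (in_setT_ord i)) -!sigma_delE.
set X := sigma_del k.+1 lam i in H *; set Y := sigma_del k lam i in H *.
set Z := sigma_del l lam i in H *; set W := sigma_del l.+1 lam i in H *.
rewrite -subr_ge0.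
have -> : Y * (W + lam ord0 i * Z) - (X + lam ord0 i * Y) * Z -
   n%:R / k.+1%:R * ((k.+1%:R - l.+1%:R) / (n%:R - l.+1%:R)) * (Y * W)
  = (l.+1%:R * (n%:R - k.+1%:R) * (Y * W)
     - k.+1%:R * (n%:R - l.+1%:R) * (X * Z)) / (k.+1%:R * (n%:R - l.+1%:R)).
  by field; rewrite !nat1r !gt_eqF.
by rewrite divr_ge0 ?subr_ge0// mulr_ge0 ?ltW.
Qed.

Lemma c0_ge0 (delta eps : R) : (2 <= n)%N -> 0 <= delta ->
  0 <= c0 n delta eps.
Proof.
move=> n2 d0; have n2R : 2 <= n%:R :> R by rewrite ler_nat.
by rewrite /c0 le_min !(sqr_ge0, divr_ge0, mulr_ge0)//; lra.
Qed.

Lemma c0_le1 (delta eps : R) : (2 <= n)%N -> 0 < delta < 1 -> 0 < eps < 1 ->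
  c0 n delta eps <= 1.
Proof.
move=> n2 /andP[d0 d1] /andP[e0 e1].
have n2R : 2 <= n%:R :> R by rewrite ler_nat.
rewrite /c0 ge_min; apply/orP; right; rewrite ler_pdivrMr; last by lra.
have : eps ^+ 2 * delta <= 1.
  by rewrite mulr_ile1 ?sqr_ge0 ?expr_le1 ?ltW.
lra.
Qed.

(** [esp_del_lower] gives
    [eps^2 delta x sigma_m(.|i) <= 2 (n-1) sigma_(m+1)(.|i)] with
    [x = lam ord0 i].  For [c = eps^2 delta / (4 (n-1))] the two parts of
    [c sigma_(m+1)] are then at most [1/2] and [1/4] of [sigma_(m+1)(.|i)]. *)
Lemma sigma_del_ge m lam i y (delta eps M : R) :
  cone (fun a => lam ord0 a) [set: 'I_n] m.+2 ->
  y != i -> lam ord0 y <= 0 -> 0 < lam ord0 i ->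
  0 < delta < 1 -> 0 < eps < 1 ->
  (forall a, a != i -> lam ord0 a <= M) ->
  delta * M <= lam ord0 i -> eps * lam ord0 i <= - lam ord0 y ->
  c0 n delta eps * sigma m.+1 lam <= sigma_del m.+1 lam i.
Proof.
move=> cT yi y0 x0 /andP[d0 d1] /andP[e0 e1] xM dM ey.
have mn := cone_card cT; rewrite cardsT card_ord in mn.
have n2R : m.+2%:R <= n%:R :> R by rewrite ler_nat.
have n2 : (2 <= n)%N := @leq_trans m.+2 2 n isT mn.
have n2R' : 2 <= n%:R :> R by rewrite ler_nat.
have cB := cone_del (in_setT_ord i) cT.
have yB : y \in [set: 'I_n] :\ i by rewrite in_setD1 yi finset.in_setT.
have xMB a : a \in [set: 'I_n] :\ i -> lam ord0 a <= M.
  by rewrite in_setD1 => /andP[/xM].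
have := esp_del_lower (in_setT_ord i) yB y0 xMB cT.
have := cB m.+1 (leqnn _); have := cB m (leqnSn _).
rewrite sigmaE (espS _ _ (in_setT_ord i)) -!sigma_delE cardsT card_ord natrB//.
set p := sigma_del m lam i; set q := sigma_del m.+1 lam i.
set x := lam ord0 i in x0 dM ey *; set z := lam ord0 y in y0 ey *.
set N := n%:R in n2R n2R' *; set K := m.+2%:R in n2R *.
move=> p0 q0 H.
have z2 : (eps * x) ^+ 2 <= z ^+ 2.
  by rewrite -[z ^+ 2]sqrrN lerXn2r// nnegrE ?mulr_ge0 ?oppr_ge0// ltW.
have H1 : eps ^+ 2 * delta * (x * p) <= 2 * (N - 1) * q.
  rewrite -(ler_pM2l x0).
  have A1 : (eps * x) ^+ 2 * p <= (K * x + (N - 2) * M) * q.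
    by apply: le_trans H; rewrite ler_pM2r.
  have A2 : delta * ((eps * x) ^+ 2 * p) <= delta * ((K * x + (N - 2) * M) * q).
    by rewrite ler_pM2l.
  have A3 : (N - 2) * (delta * M) <= (N - 2) * x by rewrite ler_wpM2l//; lra.
  have A4 : delta * K * x <= N * x.
    rewrite ler_pM2r//; apply: (le_trans _ n2R).
    by rewrite ler_piMl ?ler0n// ltW.
  have A5 : (delta * K * x + (N - 2) * (delta * M)) * q
      <= (N * x + (N - 2) * x) * q.
    by rewrite ler_pM2r// lerD.
  have -> : x * (eps ^+ 2 * delta * (x * p))
      = delta * ((eps * x) ^+ 2 * p) by ring.
  apply: le_trans A2 _.
  have -> : delta * ((K * x + (N - 2) * M) * q)
      = (delta * K * x + (N - 2) * (delta * M)) * q by ring.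
  by apply: le_trans A5 _; rewrite le_eqVlt; apply/orP; left; apply/eqP; ring.
have s0 : 0 <= q + x * p by rewrite addr_ge0 ?mulr_ge0// ltW.
set c := eps ^+ 2 * delta / (4 * (N - 1)).
have cc : c0 n delta eps <= c by rewrite /c0 ge_min lexx orbT.
apply: (le_trans (ler_wpM2r s0 cc)).
have N1 : 0 < 4 * (N - 1) by lra.
rewrite /c mulrAC ler_pdivrMr// mulrDr.
have : eps ^+ 2 * delta * q <= 1 * q.
  by rewrite ler_pM2r// mulr_ile1 ?sqr_ge0 ?expr_le1 ?ltW.
nra.
Qed.

End Sigma.
Unset Implicit Arguments.
Set Strict Implicit.

(* i1, i2 and iN are the (0-based) positions of lambda_1, lambda_2, lambda_n. *)
Theorem lemma2p7 (R : realType) (n k : nat) (hk : (2 <= k <= n)%N)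
    (i1 i2 iN : 'I_n) (hi1 : nat_of_ord i1 = 0%N) (hi2 : nat_of_ord i2 = 1%N)
    (hiN : nat_of_ord iN = n.-1)
    (lam : 'rV[R]_n) (hGamma : Gamma k lam)
    (hsort : forall i j : 'I_n, (i2 <= i)%N -> (i <= j)%N ->
       lam ord0 j <= lam ord0 i)
    (delta eps : R) (hdelta : 0 < delta < 1) (heps : 0 < eps < 1)
    (hlam1 : 0 < lam ord0 i1) (hlamn : lam ord0 iN < 0)
    (hlam12 : delta * lam ord0 i2 <= lam ord0 i1)
    (hlam1n : eps * lam ord0 i1 <= - lam ord0 iN) :
  (forall m : nat, (m <= k - 1)%N ->
     c0 n delta eps * sigma m lam <= sigma_del m lam i1) /\
  (forall l : nat, (l < k)%N ->
     c1 n k l delta eps *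
       (\sum_(i < n) partial i (sigma_quot k l) lam)
     <= partial i1 (sigma_quot k l) lam).
Proof.
have /andP[d0 d1] := hdelta.
have /andP[k2 kn] := hk.
have n2 : (2 <= n)%N := leq_trans k2 kn.
have cT := cone_Gamma hGamma.
have N1 : iN != i1 by apply/eqP => E; move: hiN n2; rewrite E hi1; clear; lia.
have first_part m : (m <= k - 1)%N ->
    c0 n delta eps * sigma m lam <= sigma_del m lam i1.
  case: m => [|m] mk; last first.
    apply: (@sigma_del_ge _ _ m lam i1 iN delta eps (lam ord0 i2)) => //.
    - by apply: cone_le cT; move: k2 mk; clear; lia.
    - exact: ltW.
    move=> a ai; apply: hsort; first by rewrite hi2.
    rewrite hi2 lt0n; apply: contra ai => /eqP a0.
    by apply/eqP/ord_inj; rewrite hi1.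
  by rewrite /sigma_del !sigma0 mulr1 c0_le1.
split=> // l lk.
case: k => [//|k] in hk k2 kn hGamma cT first_part lk *.
have c00 : 0 <= c0 n delta eps by apply: c0_ge0 => //; exact: ltW.
have sig_gt0 j : (j <= k.+1)%N -> 0 < sigma j lam.
  by move=> jk; rewrite sigmaE; apply: cT.
have l0 := sig_gt0 l (ltnW lk).
have dk : c0 n delta eps * sigma k lam <= sigma_del k lam i1.
  by apply: first_part; rewrite subn1.
have dl : c0 n delta eps * sigma l lam <= sigma_del l lam i1.
  by apply: first_part; rewrite subn1 /= -ltnS.
under eq_bigr do rewrite partial_sigma_quot ?gt_eqF//.
rewrite partial_sigma_quot ?gt_eqF// -mulr_suml mulrA.
rewrite ler_pM2r ?invr_gt0 ?exprn_gt0//.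
rewrite sumrB -mulr_suml -mulr_sumr sum_dsigmaS.
have k0 : 0 < k.+1%:R :> R by rewrite ltr0n.
have kl0 : 0 < k.+1%:R - l%:R :> R by rewrite subr_gt0 ltr_nat.
have nl0 : 0 < n%:R - l%:R :> R by rewrite subr_gt0 ltr_nat (leq_trans lk).
have nk0 : 0 < n%:R - k%:R :> R by rewrite subr_gt0 ltr_nat.
have n0 : 0 < n%:R :> R by rewrite ltr0n ltnW.
have S0 : 0 <= \sum_i dsigma l lam i.
  apply: sum_dsigma_ge0 => [m ml|]; last exact: ltnW (leq_trans lk kn).
  by apply/ltW/sig_gt0; apply: ltnW; apply: ltn_trans lk.
set C := n%:R / k.+1%:R * ((k.+1%:R - l%:R) / (n%:R - l%:R)) : R.
have C0 : 0 < C by rewrite !(mulr_gt0, invr_gt0).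
apply: le_trans (sigma_quot_numerator_ge i1 cT lk); rewrite -/C.
have -> : c1 n k.+1 l delta eps
    = C * (c0 n delta eps ^+ 2 / (n%:R - k%:R)).
  rewrite /c1 -/C; congr (_ * (_ / _)).
  by rewrite -[k.+1%:R]natr1; ring.
apply: (@le_trans _ _ (C * (c0 n delta eps ^+ 2 / (n%:R - k%:R)) *
    ((n%:R - k%:R) * sigma k lam * sigma l lam))).
  rewrite ler_wpM2l//.
    by rewrite !mulr_ge0 ?sqr_ge0 ?invr_ge0// ltW.
  by rewrite lerBlDr lerDl mulr_ge0// ltW// sig_gt0.
have -> : C * (c0 n delta eps ^+ 2 / (n%:R - k%:R)) *
    ((n%:R - k%:R) * sigma k lam * sigma l lam)
  = C * ((c0 n delta eps * sigma k lam) * (c0 n delta eps * sigma l lam)).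
  by field; rewrite gt_eqF.
by rewrite ler_pM2l// ler_pM// mulr_ge0// ltW// sig_gt0// ltnW.
Qed.
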